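(* Let $\mu$ be a probability measure on $[0,\infty)$ with mean $1$ such that $\Lambda_\mu$ is finite on a neighborhood of $0$, and let $P$ be a probability measure on $(\Omega,\mathcal{M})$. (1) If $Q\ll P$ and there is $r_0>0$ such that $P(dQ/dP\ge r)\ge G_\mu(r)$ for all $r\in[0,r_0]$ and $P(dQ/dP\ge r)\le G_\mu(r)$ for all $r>r_0$, then $Q\in\mathcal{U}^\mu(P)$. (2) Suppose $Q_0\in\mathcal{U}^\mu(P)$ and $Q\ll P$ is a probability measure. If there is $r_0>0$ such that, $P$-a.s., $r_0 1_{dQ_0/dP\le r_0}\ge\frac{dQ}{dP}1_{dQ_0/dP\le r_0}\ge\frac{dQ_0}{dP}1_{dQ_0/dP\le r_0}$ and $r_01_{dQ_0/dP\ge r_0}\le\frac{dQ}{dP}1_{dQ_0/dP\ge r_0}\le\frac{dQ_0}{dP}1_{dQ_0/dP\ge r_0}$, then $Q\in\mathcal{U}^\mu(P)$. (3) Suppose $Q_0\in\mathcal{U}^\mu(P)$, $Q$ is a probability measure, and $\nu$ is a $\sigma$-finite positive measure with $dQ_0=q_0\,d\nu$, $dP=p\,d\nu$, $dQ=q\,d\nu$. If there is $r_0>0$ such that $q(x)$ lies between $q_0(x)$ and $r_0p(x)$ for $\nu$-a.e. $x$, then $Q\in\mathcal{U}^\mu(P)$.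
   Context: For a probability measure $\mu$ on $[0,\infty)$ with mean $1$, $G_\mu(r)=\mu([r,\infty))$ for $r\ge0$ and $\Lambda_\mu(\lambda)=\log\big((\lambda+1)\int_0^\infty G_\mu(z)z^\lambda\,dz\big)$ for $\lambda\ge0$. With $\Lambda_Q^f(\lambda)=\log E_Q[e^{\lambda f}]$, and $\Lambda_\mu$ finite near $0$, $\mathcal{U}^\mu(P)=\{Q \text{ probability measure}: Q\ll P,\ \Lambda_Q^{\log(dQ/dP)}(\lambda)\le\Lambda_\mu(\lambda)\ \text{for all }\lambda>0\}$. *)

(* Defs.v *)
From HB Require Import structures.
From mathcomp Require Import all_boot all_order all_algebra.
From mathcomp Require Import all_classical all_reals all_analysis.
Set Implicit Arguments. Unset Strict Implicit. Unset Printing Implicit Defensive.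
Import Order.TTheory GRing.Theory Num.Theory.
Import numFieldNormedType.Exports.
Local Open Scope classical_set_scope.
Local Open Scope ring_scope.

(* [is_density P Q f] : f is (a version of) the Radon-Nikodym derivative
   dQ/dP, i.e. f >= 0 is measurable and Q(A) = int_A f dP for all
   measurable A.  Q << P holds iff such an f exists. *)
Definition is_density (d : measure_display) (T : measurableType d)
  (R : realType) (P Q : set T -> \bar R) (f : T -> R) : Prop :=
  [/\ measurable_fun setT f, (forall x, 0 <= f x) &
      forall A, measurable A -> Q A = (\int[P]_(x in A) (f x)%:E)%E].

Definition G_mu (R : realType) (mu : probability R R) (r : R) : \bar R :=
  mu [set` `[r, +oo[%classic].

Definition Lambda_mu (R : realType) (mu : probability R R) (lam : R) : \bar R :=
  lne (((lam + 1)%:E *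
        \int[@lebesgue_measure R]_(z in `[0%R, +oo[%classic) (G_mu mu z * (z `^ lam)%:E))%E).

Definition Lambda_Q (d : measure_display) (T : measurableType d)
  (R : realType) (Q : set T -> \bar R) (g : T -> R) (lam : R) : \bar R :=
  lne (\int[Q]_x (expR (lam * g x))%:E)%E.

Definition in_U (R : realType) (mu : probability R R)
  (d : measure_display) (T : measurableType d) (P Q : probability T R) : Prop :=
  exists f : T -> R, is_density P Q f /\
    forall lam : R, 0 < lam -> (Lambda_Q Q (fun x => ln (f x)) lam <= Lambda_mu mu lam)%E.

(* Main.v *)
(* For a density f = dQ/dP one has E_Q[e^(l log f)] = E_P[f^(l+1)], and by the
   layer-cake formula this is (l+1) int_0^oo P(f >= z) z^l dz.  If the tails of
   two nonnegative variables of mean 1 cross once, at r0, then the difference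
   of the tails times z^l - r0^l has constant sign, which orders these moments.
   Part (1) compares f with the identity under mu, part (2) compares dQ/dP with
   dQ0/dP, and part (3) reduces to (2) with dQ/dP = q/p. *)
Require Import Defs.
From HB Require Import structures.
From mathcomp Require Import all_boot all_order all_algebra.
From mathcomp Require Import all_classical all_reals all_analysis.
From mathcomp Require Import measurable_realfun.
From mathcomp Require Import ring.
Set Implicit Arguments. Unset Strict Implicit. Unset Printing Implicit Defensive.
Import Order.TTheory GRing.Theory Num.Theory.
Import numFieldNormedType.Exports.
Local Open Scope classical_set_scope.
Local Open Scope ring_scope.

(** * Change of measure by a density *)

(** Change of variables holds for the Radon-Nikodym derivative [h] of [P]. It transfers to [p],
    because [p] and [h] have the same integral on every measurable set and so agree a.e. *)
Lemma ge0_integral_density (d : measure_display) (T : measurableType d)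
    (R : realType) (nu : {sigma_finite_measure set T -> \bar R})
    (P : probability T R) (p : T -> R) (g : T -> \bar R) (A : set T) :
  is_density nu P p -> measurable A -> measurable_fun [set: T] g ->
  (forall x, 0 <= g x)%E ->
  (\int[P]_(x in A) g x = \int[nu]_(x in A) (g x * (p x)%:E))%E.
Proof.
move=> [mp p0 Pp] mA mg g0.
have Pnu : P `<< nu.
  apply/null_content_dominatesP => E mE nuE; rewrite Pp//.
  by apply: null_set_integral => //; exact/measurable_EFinP/measurable_funTS.
rewrite -(Radon_Nikodym_SigmaFinite.change_of_variables Pnu)//; last first.
  exact: measurable_funTS.
set h := Radon_Nikodym_SigmaFinite.f P nu.
have hi : nu.-integrable setT h by exact: Radon_Nikodym_SigmaFinite.f_integrable.
have mh := measurable_int _ hi.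
apply: ae_eq_integral => //.
- by apply: emeasurable_funM; exact: measurable_funTS.
- apply: emeasurable_funM; first exact: measurable_funTS.
  exact/measurable_EFinP/measurable_funTS.
- apply: ae_eqe_mul2l; apply: integral_ae_eq => //.
  + exact: integrableS hi.
  + exact/measurable_EFinP/measurable_funTS.
  + move=> E _ mE; rewrite -Pp//.
    by rewrite -(Radon_Nikodym_SigmaFinite.f_integral Pnu).
Qed.

(** * Power functions and the layer-cake formula *)

Lemma continuous_at_powR (R : realType) (l x : R) : 0 < x ->
  {for x, continuous (fun z => z `^ l)}.
Proof.
move=> x0; apply: differentiable_continuous; apply/derivable1_diffP.
by apply: derivable_powR; rewrite in_itv/= x0.
Qed.

Lemma powR_right_continuous0 (R : realType) (l : R) : 0 <= l ->
  z `^ l @[z --> 0^'+] --> (0 : R) `^ l.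
Proof.
rewrite le_eqVlt => /predU1P[<-|l0].
  by under eq_cvg do rewrite powRr0; rewrite powRr0; exact: cvg_cst.
by rewrite powR0 ?gt_eqF//; exact: powR_cvg0.
Qed.

(** Fundamental theorem of calculus with antiderivative z^(l+1). Derivatives are taken only at
    positive z; the endpoint 0 enters through right continuity. *)
Lemma integral_powR (R : realType) (l b : R) : 0 <= l -> 0 <= b ->
  (\int[lebesgue_measure]_(z in `[0%R, b]) ((l + 1) * z `^ l)%:E =
   (b `^ (l + 1))%:E)%E.
Proof.
move=> l0; have l1 : 0 < l + 1 by rewrite ltr_wpDl.
rewrite le_eqVlt => /predU1P[<-|b0].
  by rewrite set_itv1 integral_set1 powR0 ?gt_eqF.
rewrite (@continuous_FTC2 _ _ (fun z => z `^ (l + 1)))//.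
- by rewrite powR0 ?gt_eqF// sube0.
- apply/continuous_within_itvP => //; split.
  + move=> x; rewrite in_itv/= => /andP[x0 _].
    by apply: cvgM; [exact: cvg_cst|exact: continuous_at_powR].
  + by apply: cvgM; [exact: cvg_cst|exact: powR_right_continuous0].
  + apply: cvgM; [exact: cvg_cst|apply: cvg_at_left_filter].
    exact: continuous_at_powR.
- split.
  + move=> x; rewrite in_itv/= => /andP[x0 _].
    by apply: derivable_powR; rewrite in_itv/= x0.
  + exact: powR_right_continuous0 (ltW l1).
  + by apply: cvg_at_left_filter; exact: continuous_at_powR.
- move=> x; rewrite in_itv/= => /andP[x0 _].
  by rewrite powR_derive1 ?in_itv/= ?x0// addrK.
Qed.

Lemma measurable_set_ler (d : measure_display) (T : measurableType d)
    (R : realType) (f g : T -> R) :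
  measurable_fun [set: T] f -> measurable_fun [set: T] g ->
  measurable [set x | f x <= g x].
Proof.
move=> mf mg; rewrite -[X in measurable X]setTI.
exact: measurable_fun_le.
Qed.

Lemma measurable_subgraph (d : measure_display) (T : measurableType d)
    (R : realType) (f : T -> R) : measurable_fun [set: T] f ->
  measurable [set p : T * measurableTypeR R | p.2 <= f p.1].
Proof.
by move=> mf; apply: measurable_set_ler => //; exact: measurableT_comp.
Qed.

(** The tail at height z is the measure of the section of the subgraph of [f] at z, so measurability
    of section measures applies. *)
Lemma measurable_tail (d : measure_display) (T : measurableType d)
    (R : realType) (P : {sigma_finite_measure set T -> \bar R}) (f : T -> R) :
  measurable_fun [set: T] f ->
  measurable_fun [set: measurableTypeR R] (fun z => P [set x | z <= f x]).
Proof.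
move=> mf; have /= := measurable_fun_ysection P (measurable_subgraph mf).
by apply: eq_measurable_fun => z _ /=; congr (P _); apply/seteqP; split => x;
  rewrite /ysection/= inE.
Qed.

(** Each f(x)^(l+1) is the integral of (l+1) z^l over [0, f(x)]; Tonelli then exchanges x and z over
    the region [A]. *)
Lemma layer_cake_powR (d : measure_display) (T : measurableType d)
    (R : realType) (P : {sigma_finite_measure set T -> \bar R}) (f : T -> R)
    (l : R) : measurable_fun [set: T] f -> (forall x, 0 <= f x) -> 0 <= l ->
  (\int[P]_x (f x `^ (l + 1))%:E = (l + 1)%:E *
   \int[lebesgue_measure]_(z in `[0%R, +oo[) (P [set x | (z <= f x)%R] * (z `^ l)%:E))%E.
Proof.
move=> mf f0 l0; have l1 : 0 <= l + 1 by rewrite addr_ge0.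
have mpow : measurable_fun [set: measurableTypeR R] (fun z => (z `^ l)%:E).
  by apply/measurable_EFinP; exact: measurable_powR.
pose D : set (measurableTypeR R) := `[0%R, +oo[%classic.
pose A := [set p : T * measurableTypeR R | p.2 <= f p.1] `&` (setT `*` D).
have mA : measurable A.
  apply: measurableI; first exact: measurable_subgraph.
  by apply: measurableX => //; exact: measurable_itv.
pose h (p : T * measurableTypeR R) : \bar R :=
  (((l + 1) * p.2 `^ l)%:E * (\1_A p)%:E)%E.
have mh : measurable_fun setT h.
  apply: emeasurable_funM; last exact/measurable_EFinP.
  apply/measurable_EFinP; apply: measurable_funM => //.
  by apply: (measurableT_comp (measurable_powR l)).
have h0 p : (0 <= h p)%E by rewrite mule_ge0// lee_fin mulr_ge0// powR_ge0.
transitivity (\int[P]_x \int[lebesgue_measure]_z h (x, z))%E.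
  apply: eq_integral => x _; rewrite -integral_powR// integral_mkcond.
  apply: eq_integral => z _; rewrite patchE /h indicE /A /D.
  case: ifPn => [|]; rewrite ?inE/= ?notin_setE/= in_itv/=.
    move=> /andP[z0 zf]; rewrite mem_set ?mule1//=; split => //.
    by rewrite in_itv/= z0.
  move=> zf; rewrite memNset ?mule0//= in_itv/= => -[zfx [_]].
  by rewrite andbT => z0; apply: zf; rewrite z0.
rewrite -ge0_integralZl//; last 2 first.
- apply: emeasurable_funM; last exact: measurable_funTS.
  by apply: measurable_funTS; exact: measurable_tail.
- by move=> z _; rewrite mule_ge0// lee_fin powR_ge0.
rewrite (fubini_tonelli h)// [RHS]integral_mkcond.
apply: eq_integral => z _; rewrite patchE; case: ifPn => [|]; last first.
  rewrite notin_setE => zD; rewrite /fubini_G; apply: integral0_eq => x _.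
  by rewrite /h indicE memNset ?mule0//= => -[_ []].
rewrite inE => zD.
transitivity (\int[P]_x (((l + 1) * z `^ l)%:E *
    (\1_[set y | (z <= f y)%R] x)%:E))%E.
  apply: eq_integral => x _; rewrite /h !indicE; congr (_ * (_ : bool)%:R%:E)%E.
  by apply/idP/idP; rewrite !inE//= => -[].
rewrite ge0_integralZl//.
- rewrite integral_indic ?setIT//; last exact: measurable_set_ler.
  by rewrite EFinM -muleA; congr (_ * _)%E; rewrite muleC.
- by apply/measurable_EFinP/measurable_indic; exact: measurable_set_ler.
- by rewrite lee_fin mulr_ge0// powR_ge0.
Qed.

(** Turns a mean-one hypothesis into a statement about the area under the tail. *)
Lemma integral_tail (d : measure_display) (T : measurableType d)
    (R : realType) (P : {sigma_finite_measure set T -> \bar R}) (f : T -> R) :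
  measurable_fun [set: T] f -> (forall x, 0 <= f x) ->
  (\int[P]_x (f x)%:E =
   \int[lebesgue_measure]_(z in `[0%R, +oo[) P [set x | (z <= f x)%R])%E.
Proof.
move=> mf f0; have := layer_cake_powR P mf f0 (lexx 0).
rewrite add0r mul1e; under eq_integral do rewrite powRr1//.
by move=> ->; apply: eq_integral => z _; rewrite powRr0 mule1.
Qed.

(** * Moment comparison for tails that cross once *)

(** Both tails have area 1, so c times either tail integrates to c, and the claim reduces to a
    pointwise inequality between integrands. Two separate spaces are allowed so that [mu] on the
    line can serve as [P']. *)
Lemma le_integral_powR_crossing (d d' : measure_display) (T : measurableType d)
    (T' : measurableType d') (R : realType) (P : probability T R)
    (P' : probability T' R) (f : T -> R) (f' : T' -> R) (r0 l : R) :
  measurable_fun [set: T] f -> (forall x, 0 <= f x) ->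
  measurable_fun [set: T'] f' -> (forall x, 0 <= f' x) ->
  (\int[P]_x (f x)%:E = 1)%E -> (\int[P']_x (f' x)%:E = 1)%E ->
  (forall r, 0 <= r <= r0 ->
    (P' [set x | (r <= f' x)%R] <= P [set x | (r <= f x)%R])%E) ->
  (forall r, r0 < r ->
    (P [set x | (r <= f x)%R] <= P' [set x | (r <= f' x)%R])%E) ->
  0 <= r0 -> 0 <= l ->
  (\int[P]_x (f x `^ (l + 1))%:E <= \int[P']_x (f' x `^ (l + 1))%:E)%E.
Proof.
move=> mf f0 mf' f'0 Pf Pf' below above r00 l0.
rewrite !layer_cake_powR//; apply: lee_wpmul2l; first by rewrite lee_fin addr_ge0.
rewrite integral_tail// in Pf; rewrite integral_tail// in Pf'.
set D := (`[0, +oo[%classic : set R) in Pf Pf' *.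
set F := (fun z : R => P [set x | (z <= f x)%R]) in Pf *.
set F' := (fun z : R => P' [set x | (z <= f' x)%R]) in Pf' *.
have mF : measurable_fun D F by apply: measurable_funTS; exact: measurable_tail.
have mF' : measurable_fun D F' by apply: measurable_funTS; exact: measurable_tail.
have mpow : measurable_fun D (fun z => (z `^ l)%:E).
  by apply/measurable_EFinP/measurable_funTS; exact: measurable_powR.
pose c := r0 `^ l.
have c0 : 0 <= c by exact: powR_ge0.
have cF : (\int[lebesgue_measure]_(z in D) (c%:E * F z) = c%:E)%E.
  by rewrite ge0_integralZl ?Pf ?mule1//; exact: measurable_itv.
have cF' : (\int[lebesgue_measure]_(z in D) (c%:E * F' z) = c%:E)%E.
  by rewrite ge0_integralZl ?Pf' ?mule1//; exact: measurable_itv.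
have mD : measurable D by exact: measurable_itv.
(* Adding c to both sides avoids subtracting possibly infinite integrals. *)
rewrite -(@leeD2rE _ c%:E)// -{1}cF' -[X in (_ <= _ + X)%E]cF.
rewrite -!ge0_integralD//; do ?[
  by move=> z _; rewrite mule_ge0// lee_fin powR_ge0 |
  by apply: emeasurable_funM | by apply: measurable_funeM |
  by move=> z _; rewrite mule_ge0// lee_fin].
apply: ge0_le_integral => //.
- by move=> z _; rewrite adde_ge0// mule_ge0// lee_fin powR_ge0.
- by apply: emeasurable_funD; [exact: emeasurable_funM|exact: measurable_funeM].
- by apply: emeasurable_funD; [exact: emeasurable_funM|exact: measurable_funeM].
move=> z; rewrite /D/= in_itv/= andbT => z0.
have finF : F z \is a fin_num.
  by apply: fin_num_measure; exact: measurable_set_ler.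
have finF' : F' z \is a fin_num.
  by apply: fin_num_measure; exact: measurable_set_ler.
rewrite -/(F z) -/(F' z) -(fineK finF) -(fineK finF').
rewrite -!EFinM -!EFinD lee_fin -subr_ge0.
set a := fine (F z); set b := fine (F' z).
(* Since [c] is the value of z^l at [r0], the two factors are both nonpositive up to [r0] and both
   nonnegative beyond it. *)
rewrite [leRHS](_ : _ = (b - a) * (z `^ l - c)); last first.
  by rewrite /c; ring.
have [zr|rz] := leP z r0.
  apply: mulr_le0; rewrite subr_le0.
    by rewrite -lee_fin !fineK//; apply: below; rewrite z0.
  by apply: ge0_ler_powR => //; rewrite nnegrE.
apply: mulr_ge0; rewrite subr_ge0.
  by rewrite -lee_fin !fineK//; exact: above.
by apply: ge0_ler_powR; rewrite ?nnegrE// ltW.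
Qed.

(** * Densities, and both functionals as power moments *)

Lemma integral_expR_ln_density (d : measure_display) (T : measurableType d)
    (R : realType) (P Q : probability T R) (f : T -> R) (l : R) :
  is_density P Q f -> 0 < l ->
  (\int[Q]_x (expR (l * ln (f x)))%:E = \int[P]_x (f x `^ (l + 1))%:E)%E.
Proof.
move=> /[dup] Qf [mf f0 _] l0; rewrite (ge0_integral_density Qf)//.
- apply: eq_integral => x _; rewrite -EFinM; congr EFin.
  (* Where f vanishes, the density factor kills the exponential whatever [ln] returns at 0, and the
     right side is 0 because the exponent is positive. *)
  have [->|fx] := eqVneq (f x) 0.
    by rewrite mulr0 powR0// gt_eqF// addr_gt0.
  rewrite powRD ?fx ?implybT// powRr1//; congr (_ * _).
  by rewrite /powR (negbTE fx).
- apply/measurable_EFinP; apply: measurableT_comp => //.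
  by apply: measurable_funM => //; exact: measurableT_comp.
Qed.

(** The finite mass of [Q] makes [f] integrable even if [nu] is infinite, so equal integrals on all
    measurable sets force a.e. equality. *)
Lemma density_unique (d : measure_display) (T : measurableType d)
    (R : realType) (nu : {measure set T -> \bar R}) (Q : probability T R)
    (f g : T -> R) :
  is_density nu Q f -> is_density nu Q g -> {ae nu, forall x, f x = g x}.
Proof.
move=> [mf f0 Qf] [mg g0 Qg].
have : ae_eq nu setT (EFin \o f) (EFin \o g).
  apply: integral_ae_eq => //.
  - apply/integrableP; split; first exact/measurable_EFinP.
    under eq_integral do rewrite gee0_abs ?lee_fin//.
    by rewrite -Qf// probability_setT ltry.
  - exact/measurable_EFinP.
  - by move=> E _ mE; rewrite -Qf// -Qg.
by apply: filterS => x /(_ I) [].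
Qed.

(** Converts a.e. bounds between densities into bounds between their tails: [A] is covered by [B]
    and a null set. *)
Lemma ae_le_measure (d : measure_display) (T : measurableType d)
    (R : realType) (m : {measure set T -> \bar R}) (A B : set T) :
  measurable A -> measurable B -> {ae m, forall x, A x -> B x} ->
  (m A <= m B)%E.
Proof.
move=> mA mB [N [mN N0 AB]].
rewrite -[leRHS]adde0 -N0; apply: (le_trans _ (measureU2 m mB mN)).
apply: le_measure; rewrite ?inE//; first exact: measurableU.
move=> x Ax; have [Bx|nBx] := pselect (B x); first by left.
by right; apply: AB => /= /(_ Ax).
Qed.

Lemma density_mean (d : measure_display) (T : measurableType d)
    (R : realType) (P Q : probability T R) (f : T -> R) :
  is_density P Q f -> (\int[P]_x (f x)%:E = 1)%E.
Proof. by case=> _ _ Qf; rewrite -Qf// probability_setT. Qed.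

Lemma Lambda_Q_density (d : measure_display) (T : measurableType d)
    (R : realType) (P Q : probability T R) (f : T -> R) (l : R) :
  is_density P Q f -> 0 < l ->
  Lambda_Q Q (fun x => ln (f x)) l = lne (\int[P]_x (f x `^ (l + 1))%:E)%E.
Proof. by move=> Qf l0; rewrite /Lambda_Q (integral_expR_ln_density Qf). Qed.

Lemma le_lne_integral_powR (d d' : measure_display) (T : measurableType d)
    (T' : measurableType d') (R : realType) (P : probability T R)
    (P' : probability T' R) (f : T -> R) (f' : T' -> R) (l : R) :
  (\int[P]_x (f x `^ l)%:E <= \int[P']_x (f' x `^ l)%:E)%E ->
  (lne (\int[P]_x (f x `^ l)%:E) <= lne (\int[P']_x (f' x `^ l)%:E))%E.
Proof.
move=> ff'; rewrite lee_lne// in_itv/= leey andbT; apply: integral_ge0 => x _;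
  by rewrite lee_fin powR_ge0.
Qed.

(* The truncation Num.max x 0 matters at x < 0, where x `^ l is 1. *)
Lemma G_mu_max (R : realType) (mu : probability R R) (z : R) :
  mu `]-oo, 0%R[%classic = 0%E -> 0 <= z ->
  G_mu mu z = mu [set x | z <= Num.max x 0].
Proof.
move=> mu0; rewrite le_eqVlt => /predU1P[<-|z0]; last first.
  rewrite /G_mu set_mem_set; congr (mu _); apply/seteqP; split => x /=; rewrite in_itv/= andbT.
    by move=> zx; rewrite le_max zx.
  by rewrite le_max (leNgt z 0) z0/= orbF.
(* At z = 0 the truncated event is the whole line, while [G_mu] omits only the null negative
   half-line. *)
rewrite [X in _ = mu X](_ : _ = setT); last first.
  by apply/seteqP; split => x //= _; rewrite le_max lexx orbT.
rewrite /G_mu set_mem_set -[LHS]adde0 -mu0 -measureU//.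
- congr (mu _); apply/seteqP; split => x //= _; rewrite !in_itv/= andbT.
  by case: (leP 0 x) => _; [left|right].
- apply/seteqP; split => x //=; rewrite !in_itv/= andbT => -[x0].
  by rewrite ltNge x0.
Qed.

(** The integral defining [Lambda_mu] is the layer-cake expression of the truncated identity under
    [mu]; this gives the same form as [Lambda_Q_density]. *)
Lemma Lambda_muE (R : realType) (mu : probability R R) (l : R) :
  mu `]-oo, 0%R[%classic = 0%E -> 0 <= l ->
  Lambda_mu mu l = lne (\int[mu]_x (Num.max x 0 `^ (l + 1))%:E)%E.
Proof.
move=> mu0 l0; rewrite layer_cake_powR//; last 2 first.
- exact: measurable_maxr.
- by move=> x; rewrite le_max lexx orbT.
rewrite /Lambda_mu; congr (lne (_ * _)); apply: eq_integral => z.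
by rewrite inE/= in_itv/= andbT => z0; rewrite G_mu_max.
Qed.

Lemma integral_max0 (R : realType) (mu : probability R R) :
  mu `]-oo, 0%R[%classic = 0%E ->
  (\int[mu]_x (Num.max x 0)%:E = \int[mu]_x x%:E)%E.
Proof.
move=> mu0; apply: ae_eq_integral => //.
- by apply/measurable_EFinP; exact: measurable_maxr.

- exists `]-oo, 0%R[%classic; split => //.
  move=> x /= xP; rewrite in_itv/= ltNge; apply/negP => x0; apply: xP => _.
  by rewrite max_l.
Qed.

(** * Criteria for membership in the uncertainty set *)

Lemma in_U_crossing (R : realType) (mu : probability R R)
    (d : measure_display) (T : measurableType d) (P Q : probability T R)
    (f : T -> R) (r0 : R) :
  mu `]-oo, 0%R[%classic = 0%E -> (\int[mu]_x x%:E = 1)%E ->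
  is_density P Q f -> 0 < r0 ->
  (forall r, 0 <= r <= r0 -> (G_mu mu r <= P [set x | (r <= f x)%R])%E) ->
  (forall r, r0 < r -> (P [set x | (r <= f x)%R] <= G_mu mu r)%E) ->
  in_U mu P Q.
Proof.
move=> mu0 mu1 /[dup] Qf [mf f0 _] r00 below above; exists f; split => // l l0.
rewrite (Lambda_Q_density Qf)// Lambda_muE ?(ltW l0)//.
apply: (@le_lne_integral_powR _ _ _ _ _ _ _ _ (fun x : R => Num.max x 0)).
apply: (@le_integral_powR_crossing _ _ _ _ _ _ _ _ _ r0) => //.
- exact: measurable_maxr.
- by move=> x; rewrite le_max lexx orbT.
- exact: density_mean Qf.
- by rewrite integral_max0.
- by move=> r /[dup] /andP[r1 _] /below; rewrite G_mu_max.
- by move=> r /[dup] /above + rr; rewrite G_mu_max// ltW// (lt_trans r00).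
- exact: ltW.
- exact: ltW.
Qed.

(** Moving the density toward [r0] raises its tail at levels up to [r0] and lowers it above, so the
    tails of [f] and [f0] cross at [r0]. *)
Lemma in_U_between (R : realType) (mu : probability R R)
    (d : measure_display) (T : measurableType d) (P Q0 Q : probability T R)
    (f0 f : T -> R) (r0 : R) :
  in_U mu P Q0 -> is_density P Q0 f0 -> is_density P Q f -> 0 < r0 ->
  {ae P, forall x, f0 x <= f x <= r0 \/ r0 <= f x <= f0 x} ->
  in_U mu P Q.
Proof.
move=> [f1 [Q0f1 f1U]] Q0f0 Qf r00 ffr; exists f; split => // l l0.
apply: le_trans (f1U l l0).
have [mf f_ge0 _] := Qf; have [mf1 f1_ge0 _] := Q0f1.
(* [in_U] bounds the moments through its own version [f1] of the density, so the hypothesis is moved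
   from [f0] to [f1]. *)
have btw : {ae P, forall x, f1 x <= f x <= r0 \/ r0 <= f x <= f1 x}.
  by have := density_unique Q0f0 Q0f1; apply: filterS2 ffr => x + <-.
rewrite (Lambda_Q_density Qf)// (Lambda_Q_density Q0f1)//.
apply: le_lne_integral_powR.
apply: (@le_integral_powR_crossing _ _ _ _ _ _ _ _ _ r0) => //.
- exact: density_mean Qf.
- exact: density_mean Q0f1.
- move=> r /andP[_ rr0]; apply: ae_le_measure; [exact: measurable_set_ler..|].
  apply: filterS btw => x /= [/andP[f1f _]|/andP[rf _]] rf1.
    exact: le_trans f1f.
  exact: le_trans rf.
- move=> r rr0; apply: ae_le_measure; [exact: measurable_set_ler..|].
  apply: filterS btw => x /= [/andP[_ fr]|/andP[_ ff1]] rf.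
    (* This alternative is impossible: it gives r <= f x <= r0 < r. *)
    by have := lt_le_trans rr0 (le_trans rf fr); rewrite ltxx.
  exact: le_trans ff1.
- exact: ltW.
- exact: ltW.
Qed.

Lemma in_U_between_densities (R : realType) (mu : probability R R)
    (d : measure_display) (T : measurableType d) (P Q0 Q : probability T R)
    (nu : {sigma_finite_measure set T -> \bar R}) (q0 p q : T -> R) (r0 : R) :
  in_U mu P Q0 -> is_density nu Q0 q0 -> is_density nu P p ->
  is_density nu Q q -> 0 < r0 ->
  {ae nu, forall x, q0 x <= q x <= r0 * p x \/ r0 * p x <= q x <= q0 x} ->
  in_U mu P Q.
Proof.
move=> /[dup] UQ0 [f0 [Q0f0 _]] nuQ0 nuP nuQ r00 qqr.
have [mf0 f0_ge0 Q0E] := Q0f0; have [mp p_ge0 PE] := nuP.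
have [mq q_ge0 QE] := nuQ.
(* Chain rule: [f0] times [p] is also a [nu]-density of [Q0], hence equals [q0] a.e. *)
have nuQ0' : is_density nu Q0 (fun x => f0 x * p x).
  split; [exact: measurable_funM|by move=> x; rewrite mulr_ge0|move=> A mA].
  rewrite Q0E// (ge0_integral_density nuP)//.
  exact/measurable_EFinP.
have btw : {ae nu, forall x,
    f0 x * p x <= q x <= r0 * p x \/ r0 * p x <= q x <= f0 x * p x}.
  have := density_unique nuQ0 nuQ0'.
  by apply: filterS2 qqr => x + <-.
pose f x := q x / p x.
have mf : measurable_fun [set: T] f.
  apply: measurable_funM => //.
  (* 0^-1 = 0 = 0 `^ (-1), so both sides agree where p vanishes. *)
  apply: (eq_measurable_fun (fun x => p x `^ (-1))).
    by move=> x _; rewrite powR_inv1.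
  by apply: (measurableT_comp (measurable_powR (-1))).
have f_ge0 x : 0 <= f x by rewrite divr_ge0.
have Qf : is_density P Q f.
  split => // A mA; rewrite QE// (ge0_integral_density nuP)//; last first.
    exact/measurable_EFinP.
  apply: ae_eq_integral => //.
  - exact/measurable_EFinP/measurable_funTS.
  - by apply: emeasurable_funM; apply/measurable_EFinP/measurable_funTS.
  - apply: filterS btw => x bx _; rewrite -EFinM /f; congr EFin.
    (* Where [p] vanishes, both bounds on [q] are 0, so [q] vanishes too; this is what makes [Q]
       absolutely continuous with respect to [P]. *)
    have [px|px] := eqVneq (p x) 0; last by rewrite divfK.
    move: bx; rewrite px !mulr0 => qx.
    by apply/eqP; rewrite eq_le; case: qx => /andP[-> ->].
apply: (in_U_between UQ0 Q0f0 Qf r00).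
have p_gt0 : {ae P, forall x, 0 < p x}.
  exists [set x | p x <= 0]; split.
  - exact: measurable_set_ler.
  - rewrite PE//; last exact: measurable_set_ler.
    apply: integral0_eq => x /= px; congr EFin.
    by apply/eqP; rewrite eq_le px p_ge0.
  - by move=> x /= /negP; rewrite -leNgt.
(* A [nu]-null set is [P]-null because [P] has a [nu]-density; dividing by the [P]-a.e. positive [p]
   then gives the bounds on [f]. *)
have [N [mN N0 btwN]] := btw.
have btwP : {ae P, forall x,
    f0 x * p x <= q x <= r0 * p x \/ r0 * p x <= q x <= f0 x * p x}.
  exists N; split => //; rewrite PE//; apply: null_set_integral => //.
  exact/measurable_EFinP/measurable_funTS.
apply: filterS2 p_gt0 btwP => x px.
by rewrite /f !ler_pdivlMr// !ler_pdivrMr.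
Qed.

Theorem mainTheorem8 (R : realType) (mu : probability R R)
  (mu_supp : mu [set` `]-oo, 0[%classic] = 0%E)
  (mu_mean : (\int[mu]_x x%:E = 1)%E)
  (Lam_fin : exists2 e : R, 0 < e &
      forall lam : R, 0 <= lam < e -> Lambda_mu mu lam \is a fin_num)
  (d : measure_display) (T : measurableType d) (P : probability T R) :
  (* (1) *)
  (forall (Q : probability T R) (f : T -> R), is_density P Q f ->
     (exists2 r0 : R, 0 < r0 &
        (forall r : R, 0 <= r <= r0 -> (G_mu mu r <= P [set x | (r <= f x)%R])%E) /\
        (forall r : R, r0 < r -> (P [set x | (r <= f x)%R] <= G_mu mu r)%E)) ->
     in_U mu P Q)
  /\
  (* (2) *)
  (forall (Q0 Q : probability T R) (f0 f : T -> R),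
     in_U mu P Q0 -> is_density P Q0 f0 -> is_density P Q f ->
     (exists2 r0 : R, 0 < r0 &
        {ae P, forall x, f0 x <= r0 -> r0 >= f x /\ f x >= f0 x} /\
        {ae P, forall x, f0 x >= r0 -> r0 <= f x /\ f x <= f0 x}) ->
     in_U mu P Q)
  /\
  (* (3) *)
  (forall (Q0 Q : probability T R) (nu : {measure set T -> \bar R})
          (q0 p q : T -> R),
     in_U mu P Q0 -> sigma_finite setT nu ->
     is_density nu Q0 q0 -> is_density nu P p -> is_density nu Q q ->
     (exists2 r0 : R, 0 < r0 &
        {ae nu, forall x, (q0 x <= q x <= r0 * p x) \/ (r0 * p x <= q x <= q0 x)}) ->
     in_U mu P Q).
Proof.
have mu0 : mu `]-oo, 0%R[%classic = 0%E by rewrite -mu_supp set_mem_set.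
split; [|split].
- by move=> Q f Qf [r0 r00 [below above]]; apply: in_U_crossing below above.
- move=> Q0 Q f0 f UQ0 Q0f0 Qf [r0 r00 [lo hi]].
  apply: (in_U_between UQ0 Q0f0 Qf r00).
  apply: filterS2 lo hi => x lo hi; have [f0r|f0r] := leP (f0 x) r0.
    by left; apply/andP; split; have [] := lo f0r.
  by right; apply/andP; split; have [] := hi (ltW f0r).
- move=> Q0 Q nu q0 p q UQ0 sf nuQ0 nuP nuQ [r0 r00 qqr].
  (* The hypothesis [sf] equips the same set function with the sigma-finite structure, so the
     density hypotheses on [nu] apply unchanged to [nu']. *)
  pose sF := isSFinite.Build _ _ _ _ (sfinite_measure_sigma_finite sf).
  pose sigmaF := isSigmaFinite.Build _ _ _ _ sf.
  pose nu' := HB.pack_for (SigmaFiniteMeasure.type T R) (Measure.sort nu)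
    sF sigmaF.
  exact: (in_U_between_densities (nu := nu') UQ0 nuQ0 nuP nuQ r00).
Qed.
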